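(* Let $n\ge 1$, let $A,B$ be $n\times n$ complex Hermitian matrices, and fix an integer $k\ge 1$. Put $H=A+B$, $X=A-B$, \[ Q_k=\sum_{p=0}^k\binom{k}{p}A^pB^{k-p},\qquad R_k=\operatorname{Re}Q_k=\tfrac12(Q_k+Q_k^* ),\qquad D_k=R_k-H^k . \] Suppose that there exist integers $m,\ell\ge 0$, scalars $c_1,\dots,c_m\ge 0$, $n\times n$ Hermitian matrices $F_1(H),\dots,F_m(H)$, and $n\times n$ complex matrices $W_1,\dots,W_\ell$ such that \[ D_k=\sum_{j=1}^m c_j\,[X,[X,F_j(H)]]+\sum_{q=1}^{\ell}W_q^*W_q . \] Assume moreover that: (i) if $k$ is odd, then for each $j$ one has $F_j(H)=f_j(H)$ for some increasing function $f_j:\mathbb{R}\to\mathbb{R}$; (ii) if $k$ is even, then for each $j$ one has $F_j(H)=f_j(H^2)$ for some increasing function $f_j:[0,\infty)\to\mathbb{R}$. Then $\lambda(H^k)\prec_w\lambda(R_k)$, and hence $\lambda(H^k)\prec_w\sigma(Q_k)$.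
   Context: $[U,V]=UV-VU$ denotes the commutator. For a Hermitian matrix $M$ and a real function $f$ defined on its spectrum, $f(M)$ is defined by the functional calculus (apply $f$ to the eigenvalues in an orthonormal eigenbasis). For an $n\times n$ Hermitian matrix $M$, $\lambda(M)=(\lambda_1(M),\dots,\lambda_n(M))$ is the vector of eigenvalues, counted with multiplicity, in nonincreasing order. For an $n\times n$ complex matrix $Y$, $\sigma(Y)=(\sigma_1(Y),\dots,\sigma_n(Y))$ is the vector of singular values in nonincreasing order. For $x,y\in\mathbb{R}^n$ with entries in nonincreasing order, $x\prec_w y$ ($x$ is weakly majorized by $y$) means $\sum_{i=1}^r x_i\le\sum_{i=1}^r y_i$ for all $r=1,\dots,n$. *)

(* Defs.v *)
From mathcomp Require Import all_boot all_order all_algebra.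
From mathcomp Require Import reals complex.

Set Implicit Arguments.
Unset Strict Implicit.
Unset Printing Implicit Defensive.

Import Order.TTheory GRing.Theory Num.Theory.
Local Open Scope ring_scope.
Local Open Scope sesquilinear_scope.
Local Open Scope complex_scope.

Definition commutator_mx (S : pzRingType) n (U V : 'M[S]_n) : 'M[S]_n :=
  U *m V - V *m U.

Definition re_mx (R : realType) n (Y : 'M[R[i]]_n) : 'M[R[i]]_n :=
  2%:R^-1 *: (Y + Y ^t* ).

(* For M Hermitian, P := spectralmx M is unitary, d := spectral_diag M is real,
   and M = P^* diag(d) P; the conjugated rows of P are an orthonormal
   eigenbasis. For other matrices the value is irrelevant. *)
Definition funcalc (R : realType) n (f : R -> R) (M : 'M[R[i]]_n) :
    'M[R[i]]_n :=
  (spectralmx M) ^t*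
    *m diag_mx (\row_i (f (complex.Re (spectral_diag M 0 i)))%:C)
    *m spectralmx M.

(* Meant for Hermitian M, for which all the entries of spectral_diag M, i.e.
   the eigenvalues with multiplicity, are real. *)
Definition eigvals (R : realType) n (M : 'M[R[i]]_n) : 'rV[R]_n :=
  \row_i (sort >=%R [seq complex.Re (spectral_diag M 0 j) | j : 'I_n])`_i.

Definition singvals (R : realType) n (Y : 'M[R[i]]_n) : 'rV[R]_n :=
  \row_i Num.sqrt (eigvals (Y ^t* *m Y) 0 i).

(* Meant for vectors whose entries are already in nonincreasing order. *)
Definition weakly_majorized (R : realType) n (x y : 'rV[R]_n) : Prop :=
  forall r : nat, (1 <= r <= n)%N ->
    \sum_(i < n | (i < r)%N) x 0 i <= \sum_(i < n | (i < r)%N) y 0 i.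

Definition ordered_binomial (S : pzRingType) n (k : nat) (A B : 'M[S]_n) :
    'M[S]_n :=
  \sum_(p < k.+1) (A ^+ p *m B ^+ (k - p)) *+ 'C(k, p).

(* Main.v *)
(* Diagonalise H = U^* diag(h) U with h^k nonincreasing, and take traces over the
   first r vectors of this basis. By Ky Fan's maximum principle (used twice) it
   suffices that the r-th partial trace of D_k is nonnegative. The terms W^* W
   are harmless; F_j is diagonal in the same basis, with entries g_i that are
   nonincreasing in i, and with x = U X U^* the i-th diagonal entry of
   [X,[X,F_j]] is 2 sum_i' |x_ii'|^2 (g_i - g_i'). Summed over i <= r the terms
   with i' <= r cancel by antisymmetry and those with i' > r are nonnegative.
   For the singular values, write Q = N diag(s) U with N a partial isometry, and
   apply AM-GM entrywise to the partial trace of Re Q in an eigenbasis of Re Q. *)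
Require Import Defs.
From mathcomp Require Import all_boot all_order all_algebra.
From mathcomp Require Import perm reals complex ring.

Set Implicit Arguments.
Unset Strict Implicit.
Unset Printing Implicit Defensive.

Import Order.TTheory GRing.Theory Num.Theory.
Local Open Scope ring_scope.
Local Open Scope sesquilinear_scope.
Local Open Scope complex_scope.

(** * Truncated weighted sums and sorting of finite families *)

Lemma sum_ord_lt_const (V : nmodType) n r (a : V) : (r <= n)%N ->
  \sum_(i < n | (i < r)%N) a = a *+ r.
Proof.
by move=> rn; rewrite (big_ord_narrow rn) sumr_const card_ord.
Qed.

(** With [e] the indicator of the first [r.+1] indices, centring [b] at [b r] makes each
    [(b i - b r) * (e i - t i)] nonnegative, since both factors change sign at [r]. The last
    hypothesis covers two uses: total weight exactly [r.+1], and [0 <= b r] with total weight at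
    most [r.+1]. *)
Lemma weighted_sum_le_top {R : numDomainType} {n} (r : 'I_n) (b t : 'I_n -> R) :
    (forall i j : 'I_n, (i <= j)%N -> b j <= b i) ->
    (forall i, 0 <= t i <= 1) ->
    0 <= b r * (r.+1%:R - \sum_i t i) ->
  \sum_i b i * t i <= \sum_(i < n | (i < r.+1)%N) b i.
Proof.
move=> b_noninc t01 br_ge0; pose e (i : 'I_n) : R := (i < r.+1)%N%:R.
have sume : \sum_i e i = r.+1%:R.
  rewrite /e -(@sum_ord_lt_const R n) // [RHS]big_mkcond.
  by apply: eq_bigr => i _; case: ifP.
rewrite [leRHS]big_mkcond -subr_ge0 -sumrB.
have -> : \sum_(i < n) ((if (i < r.+1)%N then b i else 0) - b i * t i) =
    \sum_i (b i - b r) * (e i - t i) + b r * (r.+1%:R - \sum_i t i).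
  rewrite -sume -sumrB mulr_sumr -big_split; apply: eq_bigr => i _.
  by rewrite /= -mulrDl subrK mulrBr /e; case: ifP => _; rewrite ?mulr1 ?mulr0.
apply: addr_ge0 => //; apply: sumr_ge0 => i _; have /andP[t0 t1] := t01 i.
rewrite /e ltnS; case: leqP => ir.
  by rewrite mulr_ge0 ?subr_ge0 // b_noninc.
by rewrite sub0r mulrN -mulNr opprB mulr_ge0 // subr_ge0 b_noninc // ltnW.
Qed.

(** Keeping the permutation itself allows the eigenvectors to be reordered along with the values. *)
Lemma sort_ge_perm {R : realDomainType} {n} (a : 'I_n -> R) :
  exists s : 'S_n,
    (forall i : 'I_n, (sort >=%R [seq a j | j : 'I_n])`_i = a (s i))
    /\ (forall i j : 'I_n, (i <= j)%N -> a (s j) <= a (s i)).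
Proof.
have /tuple_permP[s sE] : perm_eq (sort >=%R [seq a j | j : 'I_n]) [tuple a j | j < n].
  by rewrite perm_sort.
have srtE (i : 'I_n) : (sort >=%R [seq a j | j : 'I_n])`_i = a (s i).
  by rewrite sE (nth_map i) ?size_enum_ord // nth_ord_enum tnth_mktuple.
exists s; split=> // i j ij; rewrite -!srtE.
apply: (@sorted_leq_nth _ (>=%R : rel R)) => //.
- by move=> x y z /= yx xz; exact: le_trans xz yx.
- exact: ge_refl.
- exact: (sort_sorted ge_total).
all: by rewrite inE size_sort size_map size_enum_ord.
Qed.

(** * Adjoints and Gram matrices *)

Section Adjoint.
Context {C : numClosedFieldType}.

Lemma adjmxM m n p (Y : 'M[C]_(m, n)) (Z : 'M[C]_(n, p)) :
  (Y *m Z)^t* = Z^t* *m Y^t*.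
Proof. by rewrite trmx_mul map_mxM. Qed.

Lemma mulmx_adj_diag m n (Y : 'M[C]_(m, n)) i :
  (Y *m Y^t*) i i = \sum_j `|Y i j| ^+ 2.
Proof. by rewrite mxE; apply: eq_bigr => j _; rewrite !mxE normCK. Qed.

Lemma mul_adj_mx_diag m n (Y : 'M[C]_(m, n)) j :
  (Y^t* *m Y) j j = \sum_i `|Y i j| ^+ 2.
Proof. by rewrite mxE; apply: eq_bigr => i _; rewrite !mxE normCKC. Qed.

Lemma mul_adj_mx_eq0 m n (Y : 'M[C]_(m, n)) : Y^t* *m Y = 0 -> Y = 0.
Proof.
move=> Y0; apply/matrixP => i j; rewrite mxE.
have := mul_adj_mx_diag Y j; rewrite Y0 mxE => /esym/eqP.
rewrite psumr_eq0 => [/allP/(_ i)|k _]; last exact: exprn_ge0.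
by rewrite mem_index_enum sqrf_eq0 normr_eq0 => /(_ isT)/eqP.
Qed.

Lemma unitarymxPC n (U : 'M[C]_n) : U \is unitarymx -> U^t* *m U = 1%:M.
Proof. by move=> /unitarymxP/mulmx1C. Qed.

Lemma adjmx_herm n (M : 'M[C]_n) : M \is hermsymmx -> M^t* = M.
Proof. by move=> /is_hermitianmxP; rewrite expr0 scale1r. Qed.

Lemma adj_eq_herm n (M : 'M[C]_n) : M^t* = M -> M \is hermsymmx.
Proof. by move=> ME; apply/is_hermitianmxP; rewrite expr0 scale1r ME. Qed.

End Adjoint.

(** * Unitary diagonalisation, functional calculus and Ky Fan's principle *)

Section RealDiagonal.
Context {R : realType} {n : nat}.
Implicit Types (a b : 'I_n -> R) (U V M : 'M[R[i]]_n).

Definition real_diag a : 'M[R[i]]_n := diag_mx (\row_i (a i)%:C).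

Lemma mul_real_diag_mx a M i j : (real_diag a *m M) i j = (a i)%:C * M i j.
Proof. by rewrite mul_diag_mx !mxE. Qed.

Lemma mul_mx_real_diag a M i j : (M *m real_diag a) i j = M i j * (a j)%:C.
Proof. by rewrite mul_mx_diag !mxE. Qed.

Lemma adj_real_diag a : (real_diag a)^t* = real_diag a.
Proof.
rewrite tr_diag_mx map_diag_mx; congr diag_mx; apply/rowP => i.
by rewrite !mxE; apply/CrealP/complex_realP; exists (a i).
Qed.

Lemma real_diagM a b : real_diag a *m real_diag b = real_diag (fun i => a i * b i).
Proof.
apply/matrixP => i j; rewrite mul_real_diag_mx !mxE mulrnAr.
by case: eqP => [->|_]; rewrite ?mulr1n ?mulr0n // rmorphM.
Qed.

Lemma eq_real_diag a b : a =1 b -> real_diag a = real_diag b.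
Proof. by move=> ab; congr diag_mx; apply/rowP => i; rewrite !mxE ab. Qed.

Lemma real_diag_conjM U a b : U \is unitarymx ->
  U^t* *m real_diag a *m U *m (U^t* *m real_diag b *m U) =
    U^t* *m real_diag (fun i => a i * b i) *m U.
Proof.
by move=> Uu; rewrite -(real_diagM a b) !mulmxA mulmxtVK.
Qed.

Lemma real_diag_conjX U a k : U \is unitarymx ->
  (U^t* *m real_diag a *m U) ^+ k = U^t* *m real_diag (fun i => a i ^+ k) *m U.
Proof.
move=> Uu; elim: k => [|k IHk].
  rewrite expr0 /real_diag.
  have -> : \row_i (a i ^+ 0)%:C = const_mx 1 :> 'rV[R[i]]_n.
    by apply/rowP => i; rewrite !mxE.
  by rewrite diag_const_mx mulmx1 (unitarymxPC Uu).
rewrite exprS IHk -mulmxE (real_diag_conjM a (fun i => a i ^+ k) Uu).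
have aX : (fun i => a i * a i ^+ k) =1 (fun i => a i ^+ k.+1).
  by move=> i; rewrite exprS.
exact (congr1 (fun D => U^t* *m D *m U) (eq_real_diag aX)).
Qed.

(** Permuting the rows of [U] compensates for permuting the diagonal; this turns the unordered
    spectral basis into an ordered one. *)
Lemma real_diag_conj_perm U a (s : 'S_n) : U \is unitarymx ->
  exists2 U', U' \is unitarymx &
    U^t* *m real_diag a *m U = U'^t* *m real_diag (fun i => a (s i)) *m U'.
Proof.
move=> Uu; exists (row_perm s U).
  apply/unitarymxP/matrixP => i j; rewrite mxE.
  under eq_bigr do rewrite !mxE.
  have /unitarymxP/matrixP/(_ (s i) (s j)) := Uu.
  rewrite !mxE (inj_eq perm_inj) => <-.
  by apply: eq_bigr => k _; rewrite !mxE.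
apply/matrixP => i j; rewrite !mxE (reindex_inj (@perm_inj _ s)).
by apply: eq_bigr => k _; rewrite !mul_mx_real_diag !mxE.
Qed.

Lemma hermitian_spectral M : M \is hermsymmx ->
  M = (spectralmx M)^t* *m real_diag (fun i => complex.Re (spectral_diag M 0 i))
      *m spectralmx M.
Proof.
move=> Mh; have /orthomx_spectralP := hermitian_normalmx Mh.
have -> : diag_mx (spectral_diag M) =
    real_diag (fun i => complex.Re (spectral_diag M 0 i)).
  congr diag_mx; apply/rowP => i; rewrite mxE RRe_real //.
  by have /mxOverP := hermitian_spectral_diag_real Mh; apply.
by rewrite (invmx_unitary (spectral_unitarymx M)).
Qed.

Lemma real_diag_conj_herm U a : U^t* *m real_diag a *m U \is hermsymmx.
Proof.
by apply: adj_eq_herm; rewrite !adjmxM trmxCK adj_real_diag mulmxA.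
Qed.

Lemma eigvals_noninc M (i j : 'I_n) : (i <= j)%N -> eigvals M 0 j <= eigvals M 0 i.
Proof.
have [s [sE s_le]] := sort_ge_perm (fun j => complex.Re (spectral_diag M 0 j)).
by rewrite !mxE !sE; exact: s_le.
Qed.

Lemma eigvals_spectral M : M \is hermsymmx ->
  exists2 U, U \is unitarymx & M = U^t* *m real_diag (eigvals M 0) *m U.
Proof.
move=> Mh; have [s [sE _]] := sort_ge_perm (fun j => complex.Re (spectral_diag M 0 j)).
have [U Uu UE] := real_diag_conj_perm (fun i => complex.Re (spectral_diag M 0 i)) s
  (spectral_unitarymx M).
exists U; first exact: Uu.
rewrite (@eq_real_diag (eigvals M 0) (fun i => complex.Re (spectral_diag M 0 (s i)))).
  by rewrite -UE; exact: hermitian_spectral.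
by move=> i; rewrite mxE sE.
Qed.

(** [funcalc] is tied to the basis [spectralmx M]; any other unitary diagonalisation gives the same
    result. The change of basis intertwines the two diagonals, so its [(i, j)] entry vanishes unless
    [a i = b j], and hence it also intertwines their images under [f]. *)
Lemma funcalc_real_diag f a U : U \is unitarymx ->
  funcalc f (U^t* *m real_diag a *m U) = U^t* *m real_diag (fun i => f (a i)) *m U.
Proof.
move=> Uu; set M := U^t* *m _ *m U; set P := spectralmx M.
set b := fun i => complex.Re (spectral_diag M 0 i).
have Pu : P \is unitarymx := spectral_unitarymx M.
have ME : M = P^t* *m real_diag b *m P by exact/hermitian_spectral/real_diag_conj_herm.
have -> : funcalc f M = P^t* *m real_diag (fun i => f (b i)) *m P by [].
(* From here on [P] and [b] are just another unitary diagonalisation of [M]. *)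
clearbody P b.
have ab : real_diag a *m (U *m P^t*) = U *m P^t* *m real_diag b.
  have := congr1 (fun Y => U *m Y *m P^t*) ME.
  by rewrite /M !mulmxA (unitarymxP Uu) mul1mx mulmxtVK.
have fab : real_diag (fun i => f (a i)) *m (U *m P^t*) =
    U *m P^t* *m real_diag (fun i => f (b i)).
  apply/matrixP => i j; rewrite mul_real_diag_mx mul_mx_real_diag [LHS]mulrC.
  have [->|Z0] := eqVneq ((U *m P^t*) i j) 0; first by rewrite !mul0r.
  have /matrixP/(_ i j) := ab; rewrite mul_real_diag_mx mul_mx_real_diag [LHS]mulrC.
  by move=> E; rewrite (complexI (mulfI Z0 E)).
have := congr1 (fun Y => U^t* *m Y *m P) fab.
rewrite !mulmxA (unitarymxPC Uu) mul1mx => <-.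
by rewrite (mulmxKtV _ Pu).
Qed.

Lemma unitary_conj_diag_entry V U a i :
  (V *m (U^t* *m real_diag a *m U) *m V^t*) i i =
  \sum_j (a j)%:C * `|(V *m U^t*) i j| ^+ 2.
Proof.
rewrite !mulmxA -mulmxA mxE; apply: eq_bigr => j _.
have -> : (U *m V^t*) j i = ((V *m U^t*) i j)^*.
  by rewrite -{1}(trmxCK U) -adjmxM !mxE.
by rewrite mul_mx_real_diag mulrAC normCK mulrC.
Qed.

(** The squared moduli of the entries of the unitary [Z] are doubly stochastic, so the partial trace
    is a combination of the [a j] with weights [t j] in [[0, 1]] of total [r.+1]. *)
Lemma ky_fan V U a (r : 'I_n) :
    V \is unitarymx -> U \is unitarymx ->
    (forall i j : 'I_n, (i <= j)%N -> a j <= a i) ->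
  \sum_(i < n | (i < r.+1)%N) (V *m (U^t* *m real_diag a *m U) *m V^t*) i i
    <= \sum_(i < n | (i < r.+1)%N) (a i)%:C.
Proof.
move=> Vu Uu a_le; pose Z := V *m U^t*.
have Zu : Z \is unitarymx by apply: (mul_unitarymx Vu); rewrite trmxC_unitary.
pose t j := \sum_(i < n | (i < r.+1)%N) `|Z i j| ^+ 2.
under eq_bigr do rewrite unitary_conj_diag_entry.
rewrite exchange_big /=; under eq_bigr do rewrite -mulr_sumr.
apply: weighted_sum_le_top => [i j ij|j|].
- by rewrite lecR a_le.
- rewrite sumr_ge0 /=; last by move=> *; exact: exprn_ge0.
  have ->: 1 = \sum_i `|Z i j| ^+ 2.
    by rewrite -mul_adj_mx_diag (unitarymxPC Zu) mxE eqxx.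
  rewrite [leRHS](bigID (fun i : 'I_n => (i < r.+1)%N)) lerDl.
  by rewrite sumr_ge0 // => *; exact: exprn_ge0.
rewrite exchange_big /=.
under eq_bigr => i _ do rewrite -mulmx_adj_diag (unitarymxP Zu) mxE eqxx.
by rewrite sum_ord_lt_const // subrr mulr0.
Qed.

Lemma real_diag_conj_entry U a i : U \is unitarymx ->
  (U *m (U^t* *m real_diag a *m U) *m U^t*) i i = (a i)%:C.
Proof.
by move=> Uu; rewrite !mulmxA (unitarymxP Uu) mul1mx (mulmxtVK _ Uu) !mxE eqxx.
Qed.

End RealDiagonal.

(** * Diagonal entries and partial traces of double commutators *)

Section Commutator.
Context {R : realType} {n : nat}.
Implicit Types (X U : 'M[R[i]]_n).

Lemma commutator_mx_unitary_conj U X Y : U \is unitarymx ->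
  U *m commutator_mx X Y *m U^t* =
  commutator_mx (U *m X *m U^t*) (U *m Y *m U^t*).
Proof.
move=> Uu; rewrite /commutator_mx mulmxBr mulmxBl !mulmxA.
by rewrite !(mulmxKtV _ Uu).
Qed.

Lemma double_commutator_diag_entry X (f : 'I_n -> R) i : X \is hermsymmx ->
  commutator_mx X (commutator_mx X (real_diag f)) i i =
  2 * \sum_j `|X i j| ^+ 2 * ((f i)%:C - (f j)%:C).
Proof.
move=> Xh; rewrite /commutator_mx mulr_sumr !mxE -sumrB; apply: eq_bigr => j _.
have XE : X j i = (X i j)^*.
  by rewrite -{1}(adjmx_herm Xh) !mxE.
rewrite ![(_ - _ : 'M_n) _ _]mxE ![(- _ : 'M_n) _ _]mxE.
rewrite !mul_mx_real_diag !mul_real_diag_mx normCK XE.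
ring.
Qed.

Lemma double_commutator_top_trace_ge0 U X (f : 'I_n -> R) (P : pred 'I_n) :
    U \is unitarymx -> X \is hermsymmx ->
    (forall i j, P i -> ~~ P j -> f j <= f i) ->
  0 <= \sum_(i | P i) (U *m commutator_mx X
         (commutator_mx X (U^t* *m real_diag f *m U)) *m U^t*) i i.
Proof.
move=> Uu Xh f_le; rewrite !(commutator_mx_unitary_conj _ _ Uu).
have -> : U *m (U^t* *m real_diag f *m U) *m U^t* = real_diag f.
  by rewrite !mulmxA (unitarymxP Uu) mul1mx mulmxtVK.
set Z := U *m X *m U^t*.
have Zh : Z \is hermsymmx.
  by apply: adj_eq_herm; rewrite !adjmxM trmxCK mulmxA (adjmx_herm Xh).
have ZE i j : `|Z j i| = `|Z i j|.
  by rewrite -{1}(adjmx_herm Zh) !mxE norm_conjC.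
under eq_bigr do rewrite (double_commutator_diag_entry _ _ Zh).
rewrite -mulr_sumr mulr_ge0 //.
under eq_bigr do rewrite (bigID P) /=.
(* The block with both indices in [P] vanishes: [|Z i j|] is symmetric while [f i - f j] is
   antisymmetric. Only pairs crossing from [P] to its complement remain, where [f_le] applies. *)
rewrite big_split /= [X in X + _](_ : _ = 0) ?add0r.
  apply: sumr_ge0 => i Pi; apply: sumr_ge0 => j Pj.
  by rewrite mulr_ge0 ?exprn_ge0 // subr_ge0 lecR f_le.
under eq_bigr do (under eq_bigr do rewrite mulrBr; rewrite sumrB).
rewrite sumrB [X in _ - X]exchange_big /=; apply/eqP; rewrite subr_eq0; apply/eqP.
by apply: eq_bigr => i _; apply: eq_bigr => j _; rewrite ZE.
Qed.

End Commutator.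

(** * Row and column bounds for partial isometries *)

Section PartialIsometry.
Context {C : numClosedFieldType}.

(* [p := Y Y^*] is then an orthogonal projection, so
   [p_ii = \sum_j |p_ij|^2 >= p_ii^2]. *)
Lemma partial_isometry_row_le1 m n (Y : 'M[C]_(m, n)) i :
  Y *m Y^t* *m Y = Y -> \sum_j `|Y i j| ^+ 2 <= 1.
Proof.
move=> YYY; rewrite -mulmx_adj_diag; set p := Y *m Y^t*.
have pE : p *m p^t* = p by rewrite {2}/p adjmxM trmxCK mulmxA YYY.
have p_ge0 : 0 <= p i i.
  by rewrite mulmx_adj_diag sumr_ge0 // => j _; exact: exprn_ge0.
have : p i i ^+ 2 <= p i i.
  suff: p i i ^+ 2 <= (p *m p^t*) i i by rewrite pE.
  rewrite [leRHS]mulmx_adj_diag (bigD1 i) //= ger0_norm // lerDl.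
  by rewrite sumr_ge0 // => j _; exact: exprn_ge0.
have [->//|p0] := eqVneq (p i i) 0.
by rewrite -[leRHS]mulr1 expr2 ler_pM2l // lt_def p0.
Qed.

Lemma partial_isometry_col_le1 m n (Y : 'M[C]_(m, n)) j :
  Y *m Y^t* *m Y = Y -> \sum_i `|Y i j| ^+ 2 <= 1.
Proof.
move=> YYY; have := @partial_isometry_row_le1 _ _ (Y^t*) j.
under eq_bigr do rewrite !mxE norm_conjC.
by apply; rewrite -[in RHS]YYY !adjmxM mulmxA.
Qed.

Lemma partial_isometry_mull n (V Y : 'M[C]_n) : V \is unitarymx ->
  Y *m Y^t* *m Y = Y -> V *m Y *m (V *m Y)^t* *m (V *m Y) = V *m Y.
Proof.
by move=> Vu YYY; rewrite adjmxM !mulmxA (mulmxKtV _ Vu) // -2!(mulmxA V) YYY.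
Qed.

(** The gap between the two sides is [|x - y^*| ^+ 2]. *)
Lemma addCJ_le_sqr_norm (x y : C) :
  x * y + (x * y)^* <= `|x| ^+ 2 + `|y| ^+ 2.
Proof.
rewrite -subr_ge0.
have -> : `|x| ^+ 2 + `|y| ^+ 2 - (x * y + (x * y)^*) = `|x - y^*| ^+ 2.
  by rewrite !normCK rmorphB rmorphM /= conjCK; ring.
exact: exprn_ge0.
Qed.

End PartialIsometry.

(** * Partial traces of the real part against singular values *)

Section SingularValues.
Context {R : realType} {n : nat}.
Implicit Types (s : 'I_n -> R) (U V Q : 'M[R[i]]_n).

(** The columns of [Y = Q *m U^t*] are orthogonal with squared norms [s i ^+ 2]. Dividing them by
    [s i] gives [N]; since [0^-1 = 0], null columns stay null and [N] is a partial isometry even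
    when [Q] is singular. *)
Lemma polar_real_diag U Q s : U \is unitarymx ->
    Q^t* *m Q = U^t* *m real_diag (fun i => s i ^+ 2) *m U ->
  exists2 N : 'M[R[i]]_n, N *m N^t* *m N = N & Q = N *m real_diag s *m U.
Proof.
move=> Uu QQ; pose Y := Q *m U^t*.
have YY : Y^t* *m Y = real_diag (fun i => s i ^+ 2).
  by rewrite adjmxM trmxCK mulmxA -(mulmxA U) QQ !mulmxA (unitarymxP Uu) mul1mx mulmxtVK.
pose N := Y *m real_diag (fun i => (s i)^-1).
have NN : N^t* *m N = real_diag (fun i => (s i)^-1 * (s i ^+ 2 * (s i)^-1)).
  by rewrite adjmxM adj_real_diag mulmxA -(mulmxA _ _ Y) YY -mulmxA !real_diagM.
have NsE : N *m real_diag s = Y.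
  (* The Gram matrix of the difference is diagonal with entries [s i ^+ 2 * (s i^-1 * s i - 1) ^+ 2]
     up to order, which vanish whether or not [s i = 0]. *)
  apply/eqP; rewrite -subr_eq0; apply/eqP/mul_adj_mx_eq0.
  have -> : N *m real_diag s - Y = Y *m real_diag (fun i => (s i)^-1 * s i - 1).
    apply/matrixP => i j; rewrite -mulmxA real_diagM mxE [(- Y) i j]mxE.
    by rewrite !mul_mx_real_diag rmorphB mulrBr rmorph1 mulr1.
  rewrite adjmxM adj_real_diag mulmxA -(mulmxA _ _ Y) YY !real_diagM.
  rewrite /real_diag (_ : \row_i _ = 0) ?linear0 //; apply/rowP => i; rewrite !mxE.
  have [->|s0] := eqVneq (s i) 0; first by rewrite expr0n mulr0 mul0r.
  by rewrite mulVf // subrr mulr0.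
exists N; last by rewrite NsE mulmxKtV.
rewrite -mulmxA NN -mulmxA real_diagM.
congr (_ *m _); apply: eq_real_diag => i.
have [->|s0] := eqVneq (s i) 0; first by rewrite invr0 mul0r.
by field.
Qed.

Lemma re_top_trace_le_singular U V Q s (r : 'I_n) :
    U \is unitarymx -> V \is unitarymx ->
    Q^t* *m Q = U^t* *m real_diag (fun i => s i ^+ 2) *m U ->
    (forall i, 0 <= s i) -> (forall i j : 'I_n, (i <= j)%N -> s j <= s i) ->
  \sum_(i < n | (i < r.+1)%N) (V *m re_mx Q *m V^t*) i i
    <= \sum_(i < n | (i < r.+1)%N) (s i)%:C.
Proof.
move=> Uu Vu QQ s_ge0 s_le; have [N NN QE] := polar_real_diag Uu QQ.
pose G := V *m N; pose K := U *m V^t*.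
have GG : G *m G^t* *m G = G by exact: partial_isometry_mull.
have KK : K *m K^t* *m K = K.
  have /unitarymxP-> : K \is unitarymx.
    by apply: (mul_unitarymx Uu); rewrite trmxC_unitary.
  exact: mul1mx.
have trE i : (V *m re_mx Q *m V^t*) i i =
    \sum_j (s j)%:C * ((G i j * K j i + (G i j * K j i)^*) / 2).
  have GsK : V *m Q *m V^t* = G *m real_diag s *m K by rewrite QE !mulmxA.
  have -> : V *m re_mx Q *m V^t* = 2%:R^-1 *: (V *m Q *m V^t* + (V *m Q *m V^t*)^t*).
    by rewrite /re_mx -scalemxAr -scalemxAl mulmxDr mulmxDl !adjmxM trmxCK mulmxA.
  rewrite GsK mxE [(_ + _ : 'M_n) _ _]mxE [(_^t*) _ _]mxE [(_^T) _ _]mxE mxE.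
  rewrite rmorph_sum -big_split mulr_sumr; apply: eq_bigr => j _ /=.
  rewrite mul_mx_real_diag !rmorphM /=.
  have -> : ((s j)%:C)^*%R = (s j)%:C by apply/CrealP/complex_realP; exists (s j).
  ring.
(* AM-GM bounds the coefficient of [s j] in the partial trace by [t j]. The column bound for [G] and
   the row bound for [K] give [t j <= 1]; the opposite bounds give total weight at most [r.+1]. *)
pose t j := \sum_(i < n | (i < r.+1)%N) (`|G i j| ^+ 2 + `|K j i| ^+ 2) / 2.
apply: (@le_trans _ _ (\sum_j (s j)%:C * t j)).
  under [leLHS]eq_bigr do rewrite trE.
  rewrite exchange_big /=; apply: ler_sum => j _; rewrite -mulr_sumr.
  apply: ler_wpM2l; first by rewrite ler0c.
  apply: ler_sum => i _; rewrite ler_wpM2r ?invr_ge0 //; exact: addCJ_le_sqr_norm.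
have half_le1 (x y : R[i]) : x <= 1 -> y <= 1 -> (x + y) / 2 <= 1.
  by move=> x1 y1; rewrite ler_pdivrMr // mul1r (_ : 2 = 1 + 1) // lerD.
have tsum_ge0 (P : pred 'I_n) (F : 'I_n -> R[i]) : 0 <= \sum_(i | P i) `|F i| ^+ 2.
  by rewrite sumr_ge0 // => i _; exact: exprn_ge0.
have top_le (F : 'I_n -> R[i]) :
    \sum_(i < n | (i < r.+1)%N) `|F i| ^+ 2 <= \sum_i `|F i| ^+ 2.
  by rewrite [leRHS](bigID (fun i : 'I_n => (i < r.+1)%N)) lerDl.
apply: weighted_sum_le_top => [i j ij|j|]; first by rewrite lecR s_le.
- rewrite /t -mulr_suml big_split /=; apply/andP; split.
    by rewrite divr_ge0 // addr_ge0.
  apply: half_le1; apply: le_trans (top_le _) _.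
    exact: partial_isometry_col_le1.
  exact: partial_isometry_row_le1.
- rewrite mulr_ge0 ?ler0c // subr_ge0 exchange_big /=.
  rewrite -(sum_ord_lt_const _ (ltn_ord r)); apply: ler_sum => i _.
  rewrite -mulr_suml big_split /=; apply: half_le1.
    exact: partial_isometry_row_le1.
  exact: partial_isometry_col_le1.
Qed.

End SingularValues.

(** * Majorization by ordered eigenvalues and monotonicity of powers *)

Section Majorization.
Context {R : realType} {n : nat}.
Implicit Types (M Q U V : 'M[R[i]]_n).

(** Diagonal entries live in [R[i]], so the comparison is made there; [r : 'I_n] with cut [r.+1]
    encodes the range from [1] to [n]. *)
Lemma weakly_majorized_complex (x y : 'rV[R]_n) :
  (forall r : 'I_n, \sum_(i < n | (i < r.+1)%N) (x 0 i)%:C <=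
                    \sum_(i < n | (i < r.+1)%N) (y 0 i)%:C) ->
  weakly_majorized x y.
Proof.
by move=> xy [|r] // /andP[_ rn]; have := xy (Ordinal rn); rewrite -!rmorph_sum lecR.
Qed.

Lemma re_mx_herm Q : re_mx Q \is hermsymmx.
Proof.
apply: adj_eq_herm; apply/matrixP => i j; rewrite !mxE rmorphM rmorphD /= conjCK addrC.
by congr (_ * _); rewrite fmorphV rmorph_nat.
Qed.

Lemma hermitian_top_trace_le_eigvals V M (r : 'I_n) :
    V \is unitarymx -> M \is hermsymmx ->
  \sum_(i < n | (i < r.+1)%N) (V *m M *m V^t*) i i
    <= \sum_(i < n | (i < r.+1)%N) (eigvals M 0 i)%:C.
Proof.
move=> Vu Mh; have [U Uu ME] := eigvals_spectral Mh.
rewrite {1}ME; apply: (ky_fan _ Vu Uu) => i j; exact: eigvals_noninc.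
Qed.

Lemma hermitian_eigvals_diag M : M \is hermsymmx ->
  exists2 U, U \is unitarymx &
    forall i, (U *m M *m U^t*) i i = (eigvals M 0 i)%:C.
Proof.
move=> Mh; have [U Uu ME] := eigvals_spectral Mh; exists U; first exact: Uu.
by move=> i; rewrite {1}ME (real_diag_conj_entry _ _ Uu).
Qed.

Lemma gram_herm Q : Q^t* *m Q \is hermsymmx.
Proof. by apply: adj_eq_herm; rewrite adjmxM trmxCK. Qed.

Lemma gram_conj_diag_ge0 Q U i : 0 <= (U *m (Q^t* *m Q) *m U^t*) i i.
Proof.
have -> : U *m (Q^t* *m Q) *m U^t* = (Q *m U^t*)^t* *m (Q *m U^t*).
  by rewrite adjmxM trmxCK !mulmxA.
by rewrite mul_adj_mx_diag sumr_ge0 // => j _; exact: exprn_ge0.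
Qed.

Lemma eigvals_re_mx_singvals Q : weakly_majorized (eigvals (re_mx Q)) (singvals Q).
Proof.
apply: weakly_majorized_complex => r.
have [V Vu VE] := hermitian_eigvals_diag (re_mx_herm Q).
under eq_bigr do rewrite -VE.
have eig_ge0 i : 0 <= eigvals (Q^t* *m Q) 0 i.
  have [U _ UE] := hermitian_eigvals_diag (gram_herm Q).
  by rewrite -ler0c -UE gram_conj_diag_ge0.
have [U Uu QQ] := eigvals_spectral (gram_herm Q).
apply: (re_top_trace_le_singular _ Uu Vu).
(* Squaring undoes the square root because the Gram eigenvalues are nonnegative. *)
- have sE : eigvals (Q^t* *m Q) 0 =1 (fun i => singvals Q 0 i ^+ 2).
    by move=> i; rewrite [singvals _ _ _]mxE sqr_sqrtr.
  by rewrite -(eq_real_diag sE).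
- by move=> i; rewrite mxE sqrtr_ge0.
- move=> i j ij; rewrite [leLHS]mxE [leRHS]mxE ler_wsqrtr //.
  exact: eigvals_noninc.
Qed.

Lemma ler_of_odd_expr (x y : R) k : odd k -> x ^+ k <= y ^+ k -> x <= y.
Proof.
move=> ok; rewrite leNgt [in X in _ -> X]leNgt; apply: contra => yx.
(* If [x <= 0], then [y < x] makes both nonpositive, and changing signs reduces to strict
   monotonicity on nonnegative numbers. *)
have [x0|x0] := ltP 0 x; last first.
  have y0 : y < 0 by apply: lt_le_trans x0.
  rewrite -[x]opprK -[y]opprK ![(- - _) ^+ k]exprNn -signr_odd ok !mulN1r ltrN2.
  by rewrite ltrXn2r ?oppr_ge0 ?(ltW y0) ?ltrN2 //; case: (k) ok.
have [y0|y0] := leP 0 y; first by rewrite ltrXn2r //; case: (k) ok.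
by apply: (@lt_trans _ _ 0); rewrite ?exprn_gt0 // exprn_odd_lt0.
Qed.

Lemma ler_sqr_of_even_expr (x y : R) k : (0 < k)%N -> ~~ odd k ->
  x ^+ k <= y ^+ k -> x ^+ 2 <= y ^+ 2.
Proof.
move=> k0 ek; rewrite -[k]odd_double_half (negbTE ek) add0n -mul2n !exprM.
rewrite ler_pXn2r ?nnegrE ?sqr_ge0 // half_gt0.
by case: k k0 ek => [|[|]].
Qed.

(** The sorting key is [h i ^+ k], not [h i]: for even [k] the two orders can differ. *)
Lemma hermitian_sorted_expr M k : M \is hermsymmx ->
  exists (U : 'M[R[i]]_n) (h : 'I_n -> R),
    [/\ U \is unitarymx, M = U^t* *m real_diag h *m U
      & forall i j : 'I_n, (i <= j)%N -> h j ^+ k <= h i ^+ k].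
Proof.
move=> Mh; set a := fun i => complex.Re (spectral_diag M 0 i).
have [s [_ s_le]] := sort_ge_perm (fun i => a i ^+ k).
have [U Uu UE] := real_diag_conj_perm a s (spectral_unitarymx M).
exists U, (fun i => a (s i)); split; [exact: Uu| |exact: s_le].
by rewrite -UE; exact: hermitian_spectral.
Qed.

End Majorization.

(** * Nonnegative partial traces of the decomposition, and the conclusion *)

Lemma top_trace_decomposition_ge0 {R : realType} {n : nat} (U X : 'M[R[i]]_n)
    (m l : nat) (c : 'I_m -> R) (f : 'I_m -> 'I_n -> R) (W : 'I_l -> 'M[R[i]]_n)
    (P : pred 'I_n) :
    U \is unitarymx -> X \is hermsymmx -> (forall j, 0 <= c j) ->
    (forall j i i', P i -> ~~ P i' -> f j i' <= f j i) ->
  0 <= \sum_(i | P i) (U *m (\sum_(j < m) (c j)%:C *: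
           commutator_mx X (commutator_mx X (U^t* *m real_diag (f j) *m U))
         + \sum_(q < l) (W q)^t* *m W q) *m U^t*) i i.
Proof.
move=> Uu Xh c_ge0 f_le; rewrite mulmxDr mulmxDl !mulmx_sumr !mulmx_suml.
under eq_bigr do rewrite mxE !summxE.
rewrite big_split /=; apply: addr_ge0; last first.
  by apply: sumr_ge0 => i _; apply: sumr_ge0 => q _; exact: gram_conj_diag_ge0.
rewrite exchange_big; apply: sumr_ge0 => j _ /=.
under eq_bigr do rewrite -scalemxAr -scalemxAl mxE.
rewrite -mulr_sumr mulr_ge0 ?ler0c //.
by apply: double_commutator_top_trace_ge0 => // i i'; exact: f_le.
Qed.

Theorem theorem5p3 (R : realType) (n k : nat) (A B : 'M[R[i]]_n)
    (n_ge1 : (1 <= n)%N) (k_ge1 : (1 <= k)%N)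
    (hermA : A \is hermsymmx) (hermB : B \is hermsymmx) :
  let H := A + B in
  let X := A - B in
  let Q := ordered_binomial k A B in
  let D := re_mx Q - H ^+ k in
  forall (m l : nat) (c : 'I_m -> R) (F : 'I_m -> 'M[R[i]]_n)
    (W : 'I_l -> 'M[R[i]]_n)
    (c_ge0 : forall j, 0 <= c j)
    (hermF : forall j, F j \is hermsymmx)
    (decompD :
       D = \sum_(j < m) (c j)%:C *: commutator_mx X (commutator_mx X (F j))
           + \sum_(q < l) (W q) ^t* *m W q)
    (F_odd : odd k -> forall j, exists f : R -> R,
       {homo f : x y / x <= y} /\ F j = funcalc f H)
    (F_even : ~~ odd k -> forall j, exists f : R -> R,
       {in Num.nneg &, {homo f : x y / x <= y}} /\ F j = funcalc f (H ^+ 2)),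
  weakly_majorized (eigvals (H ^+ k)) (eigvals (re_mx Q))
  /\ weakly_majorized (eigvals (H ^+ k)) (singvals Q).
Proof.
move=> H X Q D m l c F W c_ge0 hermF decompD F_odd F_even.
suff HQ : weakly_majorized (eigvals (H ^+ k)) (eigvals (re_mx Q)).
  split=> // r rn; apply: le_trans (HQ r rn) _.
  exact: eigvals_re_mx_singvals.
have Hh : H \is hermsymmx.
  by apply: adj_eq_herm; rewrite linearD map_mxD (adjmx_herm hermA) (adjmx_herm hermB).
have Xh : X \is hermsymmx.
  by apply: adj_eq_herm; rewrite linearB map_mxB (adjmx_herm hermA) (adjmx_herm hermB).
have [U [h [Uu HE h_le]]] := hermitian_sorted_expr k Hh.
have HkE p : H ^+ p = U^t* *m real_diag (fun i => h i ^+ p) *m U.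
  by rewrite HE; exact: real_diag_conjX.
(* Since [h i ^+ k] is nonincreasing, so is [h i] for odd [k] and [h i ^+ 2] for even [k]; in either
   case the monotone [f] carries this over to the diagonal of [F j]. *)
have FE j : exists g : 'I_n -> R, F j = U^t* *m real_diag g *m U /\
    forall i i' : 'I_n, (i <= i')%N -> g i' <= g i.
  have [ok|ek] := boolP (odd k).
    have [f [f_le ->]] := F_odd ok j; exists (fun i => f (h i)); split.
      by rewrite HE; exact: funcalc_real_diag.
    by move=> i i' ii'; apply/f_le/(ler_of_odd_expr ok)/h_le.
  have [f [f_le ->]] := F_even ek j; exists (fun i => f (h i ^+ 2)); split.
    by rewrite HkE; exact: (funcalc_real_diag f (fun i => h i ^+ 2) Uu).
  move=> i i' ii'; apply: f_le; rewrite ?nnegrE ?sqr_ge0 //.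
  exact/(ler_sqr_of_even_expr k_ge1 ek)/h_le.
have [g gE] := fin_all_exists FE.
have Hkh : H ^+ k \is hermsymmx by rewrite HkE; exact: real_diag_conj_herm.
apply: weakly_majorized_complex => r.
(* [V] realises the sorted eigenvalues of [H ^+ k], while [U] diagonalises [H] and every [F j]. Ky
   Fan's inequality passes from [V] to [U], so the two sorted lists need not be identified. *)
have [V Vu VE] := hermitian_eigvals_diag Hkh.
under eq_bigr do rewrite -VE.
apply: le_trans (hermitian_top_trace_le_eigvals r Uu (re_mx_herm Q)).
apply: (@le_trans _ _ (\sum_(i < n | (i < r.+1)%N) (h i ^+ k)%:C)).
  by rewrite HkE; exact: ky_fan.
(* In the basis [U] the part [H ^+ k] contributes exactly the left side, leaving the partial trace
   of [D]. *)
have -> : re_mx Q = H ^+ k + D by rewrite addrC subrK.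
under [leRHS]eq_bigr do rewrite mulmxDr mulmxDl mxE {1}HkE
  (real_diag_conj_entry _ _ Uu).
rewrite big_split lerDl decompD /=.
under [X in X + _]eq_bigr do rewrite (gE _).1.
apply: top_trace_decomposition_ge0 => // j i i' ir ir'.
by apply: (gE j).2; rewrite ltnW // (leq_trans ir) // leqNgt.
Qed.
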